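(* Let $K_n$ be the complete graph on $n$ vertices. Then for any complex number $k$ and any integer $c$, $$\sum_{n\ge0}(\xi_k\zeta^c)(K_n)\frac{x^n}{n!}=e^{kx}(1+x)^c .$$ In particular, $$(\xi_1\zeta^{-1})(K_n)=(-1)^nD_n,\qquad(\xi_{-1}\zeta^{-1})(K_n)=(-1)^nA_n,$$ where $D_n$ and $A_n$ are the numbers of derangements and arrangements of $[n]=\{1,\dots,n\}$, respectively.
   Context: A graph with finite vertex set $I$ is a finite multiset of edges, each a subset of $I$ of cardinality $1$ (a half-edge) or $2$. $\mathrm G[I]$ is the set of graphs with vertex set $I$; $\mathbf G[I]$ is the complex vector space with basis $\mathrm G[I]$. For an ordered decomposition $I=S\sqcup T$ (parts may be empty), the product of $g_1\in\mathrm G[S]$ and $g_2\in\mathrm G[T]$ is their disjoint union, and the coproduct is $\Delta_{S,T}(g)=g|_S\otimes g/_S$, where $g|_S$ consists of the edges and half-edges with all endpoints in $S$, and $g/_S\in\mathrm G[T]$ consists of all edges and half-edges incident to $T$, where an edge $\{t,s\}$ with $t\in T$, $s\in S$ becomes a half-edge $\{t\}$. This makes $\mathbf G$ a connected Hopf monoid. A character $\zeta$ of $\mathbf G$ is a family of linear maps $\zeta_I:\mathbf G[I]\to\mathbb C$ which is invariant under relabeling, multiplicative ($\zeta_I(x\cdot y)=\zeta_S(x)\zeta_T(y)$ for $x\in\mathbf G[S]$, $y\in\mathbf G[T]$), and equal to $1$ on the empty graph. Characters form a group under the convolution product $(\varphi\psi)_I(g)=\sum_{I=S\sqcup T}\varphi_S(g|_S)\psi_T(g/_S)$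 (sum over all ordered decompositions), with identity $\epsilon$, $\epsilon_I=0$ for $I\neq\emptyset$ and $\epsilon_\emptyset(1)=1$. Products and integer powers of characters are taken in this group. Here $\xi_k$ is the character $(\xi_k)_I(g)=k^{|I|}$ (with $0^0=1$), and $\zeta$ is the character with $\zeta_I(g)=1$ if $g$ has no edges (joining two distinct vertices; half-edges are allowed) and $0$ otherwise. A derangement of $[n]$ is a permutation of $[n]$ without fixed points; an arrangement of $[n]$ is a permutation (linear ordering) of a subset of $[n]$. *)

(* Defs.v *)
From HB Require Import structures.
From mathcomp Require Import all_boot all_order all_fingroup all_algebra.
From mathcomp Require Import finmap boolp monalg.

Set Implicit Arguments.
Unset Strict Implicit.
Unset Printing Implicit Defensive.

Import GRing.Theory.
Local Open Scope ring_scope.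

(** An edge with a single end is a half-edge. *)
Record edge (I : finType) := Edge {
  ends :> {set I};
  _ : (#|ends| == 1%N) || (#|ends| == 2)
}.
HB.instance Definition _ I := [isSub for @ends I].
HB.instance Definition _ I := [Finite of edge I by <:].

(** A finite multiset of edges, given by its multiplicity function. *)
Definition graph (I : finType) := {ffun edge I -> nat}.
HB.instance Definition _ I := GRing.Nmodule.on (graph I).
HB.instance Definition _ I := Choice.on (graph I).

Section GraphOperations.
Local Open Scope nat_scope.

(** The image multiset of [g] under [f], where [None] means that the edge is
    discarded.  Below, [f e] is typically [insub (F e)] with [F e : {set J}];
    since [F] does not increase cardinals, this is [None] exactly when [F e] is
    empty. *)
Definition push (I J : finType) (f : edge I -> option (edge J)) (g : graph I) :
    graph J :=
  [ffun e' => \sum_(e | f e == Some e') g e].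

(** Used for bijections, and for injections in [dunion]. *)
Definition relabel (I J : finType) (s : I -> J) (g : graph I) : graph J :=
  push (fun e => insub (s @: e)) g.

(** For an injection [i] with image [X], these are g|_X and g/_(I \ X) carried
    over to [A].  In [pull_sub] the edges not contained in [X] are discarded; in
    [pull_quo] every edge [e] is replaced by its intersection with [X], so that
    an edge with one end in [X] becomes a half-edge and an edge disjoint from
    [X] is discarded. *)
Definition pull_sub (A I : finType) (i : A -> I) (g : graph I) : graph A :=
  push (fun e => if e \subset codom i then insub (i @^-1: e) else None) g.

Definition pull_quo (A I : finType) (i : A -> I) (g : graph I) : graph A :=
  push (fun e => insub (i @^-1: e)) g.

Definition restrict (I : finType) (S : {set I}) (g : graph I) :
    graph {x | x \in S} :=
  pull_sub val g.

(** The decomposition is I = S + T with T = ~: S. *)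
Definition contract (I : finType) (S : {set I}) (g : graph I) :
    graph {x | x \in ~: S} :=
  pull_quo val g.

Definition dunion (I : finType) (S : {set I})
    (g : graph {x | x \in S}) (h : graph {x | x \in ~: S}) : graph I :=
  (relabel val g + relabel val h)%R.

End GraphOperations.

Section GraphTheory.

Lemma edge_card (I : finType) (e : edge I) : (0 < #|e| <= 2)%N.
Proof. by case: e => e /= /orP[] /eqP ->. Qed.

Lemma insubE (I : finType) (X : {set I}) (e : edge I) :
  (insub X == Some e) = (X == ends e).
Proof.
apply/eqP/eqP => [|->]; last by rewrite valK.
by case: insubP => //= u _ <- [->].
Qed.

Lemma push_push (I J L : finType) (f1 : edge I -> option (edge J))
    (f2 : edge J -> option (edge L)) g :
  push f2 (push f1 g) = push (fun e => obind f2 (f1 e)) g.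
Proof.
apply/ffunP => e''; rewrite !ffunE.
under eq_bigr do rewrite ffunE.
rewrite (exchange_big_dep (fun e => obind f2 (f1 e) == Some e'')) /=; last first.
  by move=> e' e /eqP fe' /eqP ->; rewrite /= fe'.
apply: eq_bigr => e; case E: (f1 e) => [e'|] //= h.
rewrite (bigD1 e') ?h ?eqxx //= big1 ?addn0 // => x /andP[/andP[_ /eqP[->]]].
by rewrite eqxx.
Qed.

Lemma eq_push (I J : finType) (f1 f2 : edge I -> option (edge J)) g :
  f1 =1 f2 -> push f1 g = push f2 g.
Proof.
by move=> h; apply/ffunP => e; rewrite !ffunE; apply: eq_bigl => x; rewrite h.
Qed.

Lemma pushD (I J : finType) (f : edge I -> option (edge J)) (g h : graph I) :
  push f (g + h) = push f g + push f h.
Proof.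
apply/ffunP => e; rewrite !ffunE -big_split /=; apply: eq_bigr => x _.
by rewrite ffunE.
Qed.

Lemma push_none (I J : finType) (f : edge I -> option (edge J)) (g : graph I) :
  (forall e, f e = None) -> push f g = 0.
Proof. by move=> h; apply/ffunP => e; rewrite !ffunE big1 // => x; rewrite h. Qed.

Lemma push_some (I : finType) (f : edge I -> option (edge I)) (g : graph I) :
  (forall e, f e = Some e) -> push f g = g.
Proof.
move=> h; apply/ffunP => e; rewrite !ffunE (bigD1 e) ?h //= big1 ?addn0 //.
by move=> x; rewrite h => /andP[/eqP[->]]; rewrite eqxx.
Qed.

Definition cut (I J : finType) (p : pred {set I}) (F : {set I} -> {set J})
  (X : {set I}) : option (edge J) := if p X then insub (F X) else None.

Lemma cut_cut (I J L : finType) (p1 : pred {set I}) (F1 : {set I} -> {set J})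
    (p2 : pred {set J}) (F2 : {set J} -> {set L}) (X : {set I}) :
  (#|X| <= 2)%N -> (#|F1 X| <= #|X|)%N -> F2 set0 = set0 ->
  obind (fun e : edge J => cut p2 F2 (ends e)) (cut p1 F1 X)
  = cut (fun X => p1 X && p2 (F1 X)) (F2 \o F1) X.
Proof.
move=> X2 FX F20; rewrite /cut; case: (p1 X) => //=.
case: insubP => /= [u _ -> //|]; rewrite negb_or => /andP[h1 h2].
have -> : F1 X = set0.
  by apply/eqP; rewrite -cards_eq0; case: #|F1 X| (leq_trans FX X2) h1 h2 => [|[|[|]]].
by rewrite F20 insubF ?if_same // cards0.
Qed.

Lemma eq_cut (I J : finType) (p1 p2 : pred {set I}) (F1 F2 : {set I} -> {set J}) X :
  p1 X = p2 X -> (p1 X -> F1 X = F2 X) -> cut p1 F1 X = cut p2 F2 X.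
Proof. by rewrite /cut => <-; case: (p1 X) => // ->. Qed.

Lemma card_preim (A I : finType) (i : A -> I) (X : {set I}) :
  injective i -> (#|i @^-1: X| <= #|X|)%N.
Proof.
move=> inj; rewrite -(card_imset _ inj); apply: subset_leq_card.
by apply/subsetP => x /imsetP[y]; rewrite inE => h ->.
Qed.

Lemma relabelE (I J : finType) (s : I -> J) : relabel s = push (fun e : edge I => cut predT (fun X => s @: X) (ends e)).
Proof. by []. Qed.
Lemma pull_subE (I J : finType) (s : I -> J) : pull_sub s =
  push (fun e : edge J => cut (fun X => X \subset codom s) (fun X => s @^-1: X) (ends e)).
Proof. by []. Qed.
Lemma pull_quoE (I J : finType) (s : I -> J) : pull_quo s =
  push (fun e : edge J => cut predT (fun X => s @^-1: X) (ends e)).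
Proof. by []. Qed.

Definition gE := (relabelE, pull_subE, pull_quoE).

Lemma edge_le2 (I : finType) (e : edge I) : (#|e| <= 2)%N.
Proof. by case/andP: (edge_card e). Qed.

Lemma cut_some (I : finType) (p : pred {set I}) F (e : edge I) :
  p e -> F (ends e) = ends e -> cut p F e = Some e.
Proof. by rewrite /cut => -> ->; rewrite valK. Qed.

Lemma relabel_id (I : finType) (s : I -> I) (g : graph I) : s =1 id -> relabel s g = g.
Proof.
move=> h; rewrite gE push_some // => e; apply: cut_some => //.
by rewrite (eq_imset _ h) imset_id.
Qed.

Lemma relabel_comp (I J L : finType) (s : I -> J) (t : J -> L) (g : graph I) :
  relabel t (relabel s g) = relabel (t \o s) g.
Proof.
rewrite !gE push_push; apply: eq_push => e.
rewrite cut_cut ?edge_le2 ?leq_imset_card ?imset0 //.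
by apply: eq_cut => //= _; rewrite imset_comp.
Qed.

Lemma relabel_sub (A A' I : finType) (i : A -> I) (i' : A' -> I) (s : A -> A') g :
  injective i -> injective i' -> bijective s -> i' \o s =1 i ->
  relabel s (pull_sub i g) = pull_sub i' g.
Proof.
move=> ii ii' [t st ts] h; rewrite !gE push_push; apply: eq_push => e.
rewrite cut_cut ?edge_le2 ?card_preim ?imset0 //; apply: eq_cut => /=.
  rewrite andbT; apply/subsetP/subsetP => H x /H /codomP[y ->].
    by rewrite -h /= codom_f.
  by rewrite -(ts y) (h (t y) : i' (s _) = _) codom_f.
move=> _; apply/setP => x; rewrite inE -{1}(ts x) mem_imset ?inE; last exact: can_inj st.
by rewrite -(h (t x)) /= ts.
Qed.

Lemma relabel_quo (A A' I : finType) (i : A -> I) (i' : A' -> I) (s : A -> A') g :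
  injective i -> injective i' -> bijective s -> i' \o s =1 i ->
  relabel s (pull_quo i g) = pull_quo i' g.
Proof.
move=> ii ii' [t st ts] h; rewrite !gE push_push; apply: eq_push => e.
rewrite cut_cut ?edge_le2 ?card_preim ?imset0 //; apply: eq_cut => //= _.
apply/setP => x; rewrite inE -{1}(ts x) mem_imset ?inE; last exact: can_inj st.
by rewrite -(h (t x)) /= ts.
Qed.

Lemma pull_sub_relabel (A I J : finType) (i : A -> I) (s : I -> J) g :
  injective i -> injective s ->
  pull_sub (s \o i) (relabel s g) = pull_sub i g.
Proof.
move=> ii is_; have isi : injective (s \o i) by exact: inj_comp.
rewrite !gE push_push; apply: eq_push => e.
rewrite cut_cut ?edge_le2 ?leq_imset_card ?preimset0 //; apply: eq_cut => /=.
  apply/subsetP/subsetP => H x.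
    move=> xe; have /H /codomP[a /is_ ->] : s x \in s @: e by apply: imset_f.
    exact: codom_f.
  by move=> /imsetP[y /H /codomP[a ->] ->]; rewrite (codom_f (s \o i)).
by move=> _; apply/setP => x; rewrite !inE /= mem_imset.
Qed.

Lemma pull_quo_relabel (A I J : finType) (i : A -> I) (s : I -> J) g :
  injective i -> injective s ->
  pull_quo (s \o i) (relabel s g) = pull_quo i g.
Proof.
move=> ii is_; have isi : injective (s \o i) by exact: inj_comp.
rewrite !gE push_push; apply: eq_push => e.
rewrite cut_cut ?edge_le2 ?leq_imset_card ?preimset0 //; apply: eq_cut => //= _.
by apply/setP => x; rewrite !inE /= mem_imset.
Qed.

Lemma pull_sub_sub (A B I : finType) (i : A -> B) (j : B -> I) g :
  injective i -> injective j ->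
  pull_sub i (pull_sub j g) = pull_sub (j \o i) g.
Proof.
move=> ii ij; rewrite !gE push_push; apply: eq_push => e.
rewrite cut_cut ?edge_le2 ?card_preim ?preimset0 //; apply: eq_cut => /=; last first.
  by move=> _; apply/setP => x; rewrite !inE.
apply/andP/subsetP => [[/subsetP H1 /subsetP H2] x xe|H].
  case/codomP: (H1 _ xe) => y yx; subst x.
  have /H2 /codomP[z ->] : y \in j @^-1: e by rewrite inE.
  exact: (codom_f (j \o i)).
split; apply/subsetP => x; first by move=> /H /codomP[y ->]; rewrite /= codom_f.
rewrite inE => /H /codomP[y /ij ->]. by rewrite codom_f.
Qed.

Lemma pull_quo_quo (A B I : finType) (i : A -> B) (j : B -> I) g :
  injective i -> injective j ->
  pull_quo i (pull_quo j g) = pull_quo (j \o i) g.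
Proof.
move=> ii ij; rewrite !gE push_push; apply: eq_push => e.
rewrite cut_cut ?edge_le2 ?card_preim ?preimset0 //; apply: eq_cut => //= _.
by apply/setP => x; rewrite !inE.
Qed.

(* (g|_U)/_P = (g/_P)|_(U \ P) *)
Lemma pull_quo_sub (A B B' I : finType) (i : A -> B) (j : B -> I)
    (i' : A -> B') (j' : B' -> I) g :
  injective i -> injective j -> injective i' -> injective j' ->
  j \o i =1 j' \o i' ->
  (forall x, (x \in codom j) = (x \notin codom j') || (x \in codom (j \o i))) ->
  pull_quo i (pull_sub j g) = pull_sub i' (pull_quo j' g).
Proof.
move=> ii ij ii' ij' h hc; rewrite !gE !push_push; apply: eq_push => e.
rewrite !cut_cut ?edge_le2 ?card_preim ?preimset0 //; apply: eq_cut => /=.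
  rewrite andbT; apply/subsetP/subsetP => H x.
    rewrite inE => /H; rewrite hc codom_f /= => /codomP[y].
    by rewrite (h y) /= => /ij' ->; rewrite codom_f.
  move=> xe; rewrite hc; case: (boolP (x \in codom j')) => //= /codomP[y yx].
  have /H /codomP[z zy] : y \in j' @^-1: e by rewrite inE -yx.
  by rewrite yx zy -(h z : _ = j' (i' z)) codom_f.
by move=> _; apply/setP => x; rewrite !inE (h x : j (i x) = _).
Qed.

End GraphTheory.

Lemma pull_subD (A I : finType) (i : A -> I) (g h : graph I) :
  pull_sub i (g + h) = pull_sub i g + pull_sub i h.
Proof. exact: pushD. Qed.

Lemma pull_quoD (A I : finType) (i : A -> I) (g h : graph I) :
  pull_quo i (g + h) = pull_quo i g + pull_quo i h.
Proof. exact: pushD. Qed.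

Lemma pull_sub_union (A S X I : finType) (i : A -> X) (k : X -> I) (v : S -> I)
    (w : A -> S) g :
  injective i -> injective k -> injective v -> injective w -> k \o i =1 v \o w ->
  (forall x y, k x = v y -> x \in codom i) ->
  pull_sub k (relabel v g) = relabel i (pull_sub w g).
Proof.
move=> ii ik iv iw h hc; rewrite !gE !push_push; apply: eq_push => e.
rewrite !cut_cut ?edge_le2 ?card_preim ?leq_imset_card ?preimset0 ?imset0 //.
have hc' x y : k x = v y -> exists2 a, x = i a & y = w a.
  move=> E; have /codomP[a xa] := hc _ _ E; exists a => //.
  by apply: iv; rewrite -E xa; exact: h a.
apply: eq_cut => /=.
  rewrite andbT; apply/subsetP/subsetP => H x.
    move=> xe; have /H /codomP[y] : v x \in v @: e by apply: imset_f.
    by move=> /esym/hc'[a _ ->]; rewrite codom_f.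
  by move=> /imsetP[y /H /codomP[a ->] ->]; rewrite -[v (w a)](h a) /= codom_f.
move=> _; apply/setP => x; rewrite !inE; apply/imsetP/imsetP => -[y].
  by move=> ye /hc'[a -> ya]; exists a => //; rewrite inE -ya.
by rewrite inE => ye ->; exists (w y) => //; exact: h y.
Qed.

Lemma pull_quo_union (A S X I : finType) (i : A -> X) (k : X -> I) (v : S -> I)
    (w : A -> S) g :
  injective i -> injective k -> injective v -> injective w -> k \o i =1 v \o w ->
  (forall x y, k x = v y -> x \in codom i) ->
  pull_quo k (relabel v g) = relabel i (pull_quo w g).
Proof.
move=> ii ik iv iw h hc; rewrite !gE !push_push; apply: eq_push => e.
rewrite !cut_cut ?edge_le2 ?card_preim ?leq_imset_card ?preimset0 ?imset0 //.
apply: eq_cut => //= _; apply/setP => x; rewrite !inE; apply/imsetP/imsetP => -[y].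
  move=> ye E; have /codomP[a xa] := hc _ _ E; exists a => //; rewrite inE.
  suff <- : y = w a by [].
  by apply: iv; rewrite -E xa; exact: h a.
by rewrite inE => ye ->; exists (w y) => //; exact: h y.
Qed.

Lemma pull_sub_id (I : finType) (i : I -> I) (g : graph I) : i =1 id -> pull_sub i g = g.
Proof.
move=> h; rewrite gE push_some // => e; apply: cut_some => //.
  by apply/subsetP => x _; rewrite -[x]h codom_f.
by apply/setP => x; rewrite inE h.
Qed.

Lemma pull_quo_id (I : finType) (i : I -> I) (g : graph I) : i =1 id -> pull_quo i g = g.
Proof.
move=> h; rewrite gE push_some // => e; apply: cut_some => //.
by apply/setP => x; rewrite inE h.
Qed.

Lemma comm_bij (A A' I : finType) (i : A -> I) (i' : A' -> I) :
  injective i -> injective i' -> codom i =i codom i' ->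
  exists2 s : A -> A', bijective s & i' \o s =1 i.
Proof.
move=> ii ii' h.
have P a : i a \in codom i' by rewrite -h codom_f.
have Q a : i' a \in codom i by rewrite h codom_f.
exists (fun a => iinv (P a)); last by move=> a /=; rewrite f_iinv.
exists (fun a => iinv (Q a)) => a; [apply: ii|apply: ii']; by rewrite !f_iinv.
Qed.

Definition mkp (I : finType) (S : {set I}) (x : I) (xS : x \in S) : {x | x \in S} :=
  exist _ x xS.

Lemma codom_val (I : finType) (S : {set I}) x :
  (x \in codom (val : {x | x \in S} -> I)) = (x \in S).
Proof.
apply/codomP/idP => [[y ->]|xS]; first exact: valP.
by exists (mkp xS).
Qed.

Definition incl (I : finType) (U V : {set I}) (h : U \subset V)
  (u : {x | x \in U}) : {x | x \in V} := exist _ (val u) (subsetP h _ (valP u)).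

Lemma incl_inj (I : finType) (U V : {set I}) (h : U \subset V) : injective (incl h).
Proof. by move=> x y [/val_inj]. Qed.

Lemma codom_incl (I : finType) (U V : {set I}) (h : U \subset V) y :
  (y \in codom (incl h)) = (val y \in U).
Proof.
apply/codomP/idP => [[u ->]|yU]; first exact: (valP u).
by exists (exist _ (val y) yU); apply: val_inj.
Qed.

Lemma card_part (I : finType) (S : {set I}) : #|{: {x | x \in S}}| = #|S|.
Proof. by rewrite card_sig; apply: eq_card => x. Qed.

(** The next section deals with families of functions on graphs.  A family of
    linear forms on the spaces with basis [graph I] is determined by such a
    family (see [extend] below), and it is a character exactly when the family
    satisfies [b_iso], [b_mul] and [b_one]. *)

Section BasisChar.
Variable K : fieldType.
Implicit Types f h k : forall I : finType, graph I -> K.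

Definition b_iso f := forall (I J : finType) (s : I -> J) g,
  bijective s -> f J (relabel s g) = f I g.
Definition b_mul_le n f := forall (I : finType) (S : {set I}) g1 g2, (#|I| <= n)%N ->
  f I (@dunion I S g1 g2) = f _ g1 * f _ g2.
Definition b_mul f := forall (I : finType) (S : {set I}) g1 g2,
  f I (@dunion I S g1 g2) = f _ g1 * f _ g2.
Definition b_one f := forall (I : finType) (g : graph I), #|I| = 0%N -> f I g = 1.

Definition conv f h (I : finType) (g : graph I) : K :=
  \sum_(S : {set I}) f _ (restrict S g) * h _ (contract S g).

Lemma f_sub f (A A' I : finType) (i : A -> I) (i' : A' -> I) g : b_iso f ->
  injective i -> injective i' -> codom i =i codom i' ->
  f _ (pull_sub i g) = f _ (pull_sub i' g).
Proof.
by move=> fi ii ii' /(comm_bij ii ii')[s bs /(relabel_sub g ii ii' bs) <-]; rewrite fi.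
Qed.

Lemma f_quo f (A A' I : finType) (i : A -> I) (i' : A' -> I) g : b_iso f ->
  injective i -> injective i' -> codom i =i codom i' ->
  f _ (pull_quo i g) = f _ (pull_quo i' g).
Proof.
by move=> fi ii ii' /(comm_bij ii ii')[s bs /(relabel_quo g ii ii' bs) <-]; rewrite fi.
Qed.

Lemma f_sub_full f (A I : finType) (i : A -> I) g : b_iso f ->
  injective i -> (forall x, x \in codom i) -> f _ (pull_sub i g) = f _ g.
Proof.
move=> fi ii h; rewrite (f_sub g fi ii (@inj_id _)) ?pull_sub_id // => x.
by rewrite h (codom_f id).
Qed.

Lemma f_quo_full f (A I : finType) (i : A -> I) g : b_iso f ->
  injective i -> (forall x, x \in codom i) -> f _ (pull_quo i g) = f _ g.
Proof.
move=> fi ii h; rewrite (f_quo g fi ii (@inj_id _)) ?pull_quo_id // => x.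
by rewrite h (codom_f id).
Qed.

Lemma conv_iso_sum (P : pred nat) f h (I J : finType) (s : I -> J) g :
  b_iso f -> b_iso h -> bijective s ->
  \sum_(S : {set J} | P #|S|) f _ (restrict S (relabel s g)) * h _ (contract S (relabel s g))
  = \sum_(S : {set I} | P #|S|) f _ (restrict S g) * h _ (contract S g).
Proof.
move=> fi hi bs; have is_ := bij_inj bs; case: (bs) => t st ts.
rewrite (reindex (fun S : {set I} => s @: S)) /=; last first.
  exists (fun S : {set J} => t @: S) => S _.
    by rewrite -imset_comp (eq_imset _ (st : t \o s =1 id)) imset_id.
  by rewrite -imset_comp (eq_imset _ (ts : s \o t =1 id)) imset_id.
apply: eq_big => S; first by rewrite card_imset.
move=> _; congr (_ * _).
  rewrite -[RHS]/(f _ (pull_sub val g)) -[in RHS](pull_sub_relabel g val_inj is_); apply: f_sub => //.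
  - exact: val_inj.
  - exact: inj_comp is_ val_inj.
  move=> x; rewrite codom_val; apply/imsetP/codomP => [[y yS ->]|[y ->]].
    by exists (exist _ y yS).
  by exists (val y) => //; exact: valP.
rewrite -[RHS]/(h _ (pull_quo val g)) -[in RHS](pull_quo_relabel g val_inj is_); apply: f_quo => //.
- exact: val_inj.
- exact: inj_comp is_ val_inj.
move=> x; rewrite codom_val inE -{1}(ts x) mem_imset //; apply/idP/codomP => [xS|[y ->]].
  by rewrite -in_setC in xS; exists (exist _ (t x) xS); rewrite /= ts.
by rewrite /= st -in_setC; exact: valP.
Qed.

Lemma conv_iso f h : b_iso f -> b_iso h -> b_iso (conv f h).
Proof. by move=> fi hi I J s g bs; apply: (conv_iso_sum predT). Qed.

Lemma b_mul_sum n f (A B : finType) g1 g2 : b_iso f -> b_mul_le n f ->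
  (#|A| + #|B| <= n)%N ->
  f (A + B)%type (relabel inl g1 + relabel inr g2) = f A g1 * f B g2.
Proof.
move=> fi fm le.
pose S : {set A + B} := [set x | if x is inl _ then true else false].
have cl : codom (@inl A B) =i codom (val : {x | x \in S} -> _).
  move=> [a|b]; rewrite codom_val inE ?codom_f //; apply/codomP => -[] //.
have cr : codom (@inr A B) =i codom (val : {x | x \in ~: S} -> _).
  move=> [a|b]; rewrite codom_val !inE ?codom_f //; apply/codomP => -[] //.
have [s bs sE] := comm_bij (@inl_inj A B) val_inj cl.
have [t bt tE] := comm_bij (@inr_inj A B) val_inj cr.
rewrite -(fi _ _ s g1 bs) -(fi _ _ t g2 bt) -fm ?card_sum //; congr (f _ _).
rewrite /dunion !relabel_comp; congr (_ + _); apply: eq_push => e.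
  by rewrite (eq_imset _ sE).
by rewrite (eq_imset _ tE).
Qed.

Lemma part_disj (I : finType) (S : {set I}) (y : {x | x \in S}) (z : {x | x \in ~: S}) :
  val y = val z -> False.
Proof.
by case: y z => [y yS] [z zS] /= yz; move: zS; rewrite -yz inE yS.
Qed.

Definition glue (I : finType) (S : {set I})
  (U : {set {x | x \in S}} * {set {x | x \in ~: S}}) : {set I} :=
  (val @: U.1) :|: (val @: U.2).

Lemma glue_bij (I : finType) (S : {set I}) : bijective (@glue I S).
Proof.
exists (fun U : {set I} => ((val : {x | x \in S} -> I) @^-1: U,
    (val : {x | x \in ~: S} -> I) @^-1: U)).
  move=> [U1 U2]; rewrite /glue /=; congr (_, _); apply/setP => x; rewrite !inE.
    rewrite mem_imset; last exact: val_inj.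
    case: (x \in U1) => //=; apply/imsetP => -[y _]; exact: part_disj.
  rewrite orbC mem_imset; last exact: val_inj.
  case: (x \in U2) => //=; apply/imsetP => -[y _ /esym]; exact: part_disj.
move=> U; rewrite /glue; apply/setP => x; rewrite !inE /=.
apply/orP/idP => [[]/imsetP[y]|xU]; rewrite ?inE; try by move=> yU ->.
case: (boolP (x \in S)) => xS.
  by left; apply/imsetP; exists (mkp xS); rewrite ?inE.
rewrite -in_setC in xS.
by right; apply/imsetP; exists (mkp xS); rewrite ?inE.
Qed.

Definition tot (I A B : finType) (i : A -> I) (j : B -> I) (x : A + B) : I :=
  match x with inl a => i a | inr b => j b end.

Lemma glue_l (I : finType) (S : {set I}) U x : (val x \in @glue I S U) = (x \in U.1).
Proof.
rewrite inE mem_imset; last exact: val_inj.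
case: (x \in U.1) => //=; apply/imsetP => -[y _]; exact: part_disj.
Qed.

Lemma glue_r (I : finType) (S : {set I}) U x : (val x \in @glue I S U) = (x \in U.2).
Proof.
rewrite inE orbC mem_imset; last exact: val_inj.
case: (x \in U.2) => //=; apply/imsetP => -[y _ /esym]; exact: part_disj.
Qed.

Section Tot.
Variables (I : finType) (S : {set I}).
Variables (V1 : {set {x | x \in S}}) (V2 : {set {x | x \in ~: S}}) (V : {set I}).
Hypothesis h1 : forall x : {x | x \in S}, (val x \in V) = (x \in V1).
Hypothesis h2 : forall x : {x | x \in ~: S}, (val x \in V) = (x \in V2).

Let m (x : {x | x \in V1} + {x | x \in V2}) : I := tot (val \o val) (val \o val) x.

Let im : injective m.
Proof.
by move=> [a|a] [b|b] /= E; rewrite ?(val_inj (val_inj E)) //; [case: (part_disj E) | case: (part_disj (esym E))].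
Qed.

Let cm : codom m =i codom (val : {x | x \in V} -> I).
Proof.
move=> x; rewrite codom_val; apply/codomP/idP => [[[a|b] ->] /=|xV].
- by rewrite h1; exact: valP.
- by rewrite h2; exact: valP.
case: (boolP (x \in S)) => xS.
  have aV : mkp xS \in V1 by rewrite -h1.
  by exists (inl (mkp aV)).
rewrite -in_setC in xS; have aV : mkp xS \in V2 by rewrite -h2.
by exists (inr (mkp aV)).
Qed.

Let cl x (y : {x | x \in S}) : m x = val y -> x \in codom inl.
Proof. by case: x => [a|a] E; [rewrite codom_f | case: (part_disj (esym E))]. Qed.
Let cr x (y : {x | x \in ~: S}) : m x = val y -> x \in codom inr.
Proof. by case: x => [a|a] E; [case: (part_disj E) | rewrite codom_f]. Qed.

Lemma tot_sub n f g1 g2 : b_iso f -> b_mul_le n f -> (#|V| <= n)%N ->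
  f _ (pull_sub (val : {x | x \in V} -> I) (dunion g1 g2)) =
  f _ (restrict V1 g1) * f _ (restrict V2 g2).
Proof.
move=> fi fm le; rewrite -(f_sub _ fi im val_inj cm).
rewrite -(b_mul_sum _ _ fi fm); last first.
  by rewrite -card_sum (leq_trans _ le) // -(card_codom im) (eq_card cm) card_codom ?card_part //; apply: val_inj.
rewrite /dunion pull_subD; congr (f _ (_ + _)).
  by apply: pull_sub_union; first [done | exact: inl_inj | exact: val_inj | exact: cl].
by apply: pull_sub_union; first [done | exact: inr_inj | exact: val_inj | exact: cr].
Qed.

Lemma tot_quo n f g1 g2 : b_iso f -> b_mul_le n f -> (#|V| <= n)%N ->
  f _ (pull_quo (val : {x | x \in V} -> I) (dunion g1 g2)) =
  f _ (pull_quo (val : {x | x \in V1} -> _) g1) * f _ (pull_quo (val : {x | x \in V2} -> _) g2).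
Proof.
move=> fi fm le; rewrite -(f_quo _ fi im val_inj cm).
rewrite -(b_mul_sum _ _ fi fm); last first.
  by rewrite -card_sum (leq_trans _ le) // -(card_codom im) (eq_card cm) card_codom ?card_part //; apply: val_inj.
rewrite /dunion pull_quoD; congr (f _ (_ + _)).
  by apply: pull_quo_union; first [done | exact: inl_inj | exact: val_inj | exact: cl].
by apply: pull_quo_union; first [done | exact: inr_inj | exact: val_inj | exact: cr].
Qed.
End Tot.

Lemma conv_dunion_term n f h (I : finType) (S : {set I}) g1 g2 U :
  b_iso f -> b_iso h -> b_mul f -> b_mul_le n h -> (#|~: @glue I S U| <= n)%N ->
  f _ (restrict (glue U) (dunion g1 g2)) * h _ (contract (glue U) (dunion g1 g2)) =
  (f _ (restrict U.1 g1) * h _ (contract U.1 g1)) *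
  (f _ (restrict U.2 g2) * h _ (contract U.2 g2)).
Proof.
move=> fi hi fm hm le; rewrite mulrACA; congr (_ * _).
  apply: (@tot_sub _ _ _ _ _ _ _ #|I|) ; first
    [done | exact: glue_l | exact: glue_r | exact: max_card | by move=> ? ? ? ? _; rewrite fm].
by apply: tot_quo le => // x; rewrite !in_setC ?glue_l ?glue_r.
Qed.

Lemma sum_glue (I : finType) (S : {set I}) (F1 : {set {x | x \in S}} -> K) F2 :
  (\sum_U F1 U) * (\sum_U F2 U) = \sum_(U : {set {x | x \in S}} * {set {x | x \in ~: S}}) F1 U.1 * F2 U.2.
Proof. by rewrite big_distrlr /= pair_big. Qed.

Lemma conv_mul f h : b_iso f -> b_iso h -> b_mul f -> b_mul h -> b_mul (conv f h).
Proof.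
move=> fi hi fm hm I S g1 g2; rewrite /conv sum_glue (reindex _ (onW_bij _ (glue_bij S))) /=.
apply: eq_bigr => U _; by apply: (conv_dunion_term (n := #|I|)); first
  [done | exact: max_card | by move=> ? ? ? ? _; rewrite hm].
Qed.

Lemma card0_set (I : finType) : #|I| = 0%N -> forall S : {set I}, S = set0.
Proof. by move=> I0 S; apply/setP => x; have := fintype0 x; rewrite I0 => /(_ erefl). Qed.

Lemma sum_card0 (I : finType) (F : {set I} -> K) : #|I| = 0%N -> \sum_S F S = F set0.
Proof.
move=> I0; rewrite (bigD1 set0) //= big1 ?addr0 // => S.
by rewrite (card0_set I0 S) eqxx.
Qed.

Lemma card0_part (I : finType) (S : {set I}) : #|I| = 0%N -> #|{: {x | x \in S}}| = 0%N.
Proof. by move=> I0; rewrite card_part (card0_set I0 S) cards0. Qed.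

Lemma conv_one f h : b_one f -> b_one h -> b_one (conv f h).
Proof.
by move=> f1 h1 I g I0; rewrite /conv sum_card0 // f1 ?h1 ?mul1r //; apply: card0_part.
Qed.

Definition beps (I : finType) (g : graph I) : K := (#|I| == 0)%:R.

Lemma f_restrictT f (I : finType) g : b_iso f -> f _ (restrict [set: I] g) = f _ g.
Proof. by move=> fi; apply: f_sub_full => // [|x]; [exact: val_inj|rewrite codom_val inE]. Qed.
Lemma f_contract0 f (I : finType) g : b_iso f -> f _ (contract (set0 : {set I}) g) = f _ g.
Proof. by move=> fi; apply: f_quo_full => // [|x]; [exact: val_inj|rewrite codom_val !inE]. Qed.

Lemma conv_epsl f (I : finType) (g : graph I) : b_iso f -> conv beps f g = f _ g.
Proof.
move=> fi; rewrite /conv (bigD1 set0) //= f_contract0 // big1 ?addr0.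
  by rewrite /beps card_part cards0 mul1r.
by move=> S S0; rewrite /beps card_part cards_eq0 (negbTE S0) mul0r.
Qed.

Lemma conv_epsr f (I : finType) (g : graph I) : b_iso f -> conv f beps g = f _ g.
Proof.
move=> fi; rewrite /conv (bigD1 setT) //= f_restrictT // big1 ?addr0.
  by rewrite /beps card_part setCT cards0 mulr1.
by move=> S ST; rewrite /beps card_part cards_eq0 -setCT (inj_eq (@setC_inj I)) (negbTE ST) mulr0.
Qed.

Lemma sum_part (I : finType) (S : {set I}) (G : {set I} -> K) :
  \sum_(P : {set I} | P \subset S) G P =
  \sum_(Q : {set {x | x \in S}}) G (val @: Q).
Proof.
rewrite (reindex (fun Q : {set {x | x \in S}} => val @: Q)) /=.
  apply: eq_bigl => Q; apply/subsetP => x /imsetP[y _ ->]; exact: valP.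
exists (fun P : {set I} => (val : {x | x \in S} -> I) @^-1: P) => P.
  by move=> _; apply/setP => x; rewrite inE mem_imset //; exact: val_inj.
rewrite inE => /subsetP PS; apply/setP => x; apply/imsetP/idP => [[y]|xP].
  by rewrite inE => ? ->.
by exists (exist _ x (PS _ xP)); rewrite ?inE.
Qed.

Lemma sum_part_up (I : finType) (P : {set I}) (G : {set I} -> K) :
  \sum_(S : {set I} | P \subset S) G S =
  \sum_(Q : {set {x | x \in ~: P}}) G (P :|: (val @: Q)).
Proof.
rewrite -(sum_part _ (fun X => G (P :|: X))).
rewrite (reindex_onto (fun X => P :|: X) (fun S => S :\: P)) /=; last first.
  move=> S /subsetP PS; apply/setP => x; rewrite !inE.
  by case: (boolP (x \in P)) => //= /PS.
apply: eq_big => // X; rewrite subsetUl /=; apply/eqP/subsetP => [<- x|H].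
  by rewrite !inE => /andP[].
apply/setP => x; rewrite !inE; have := H x; rewrite !inE.
by case: (x \in P) => //=; case: (x \in X) => // /(_ isT).
Qed.

Lemma conv_assoc f h k (I : finType) (g : graph I) :
  b_iso f -> b_iso h -> b_iso k -> conv f (conv h k) g = conv (conv f h) k g.
Proof.
move=> fi hi ki.
pose PS (P S : {set I}) : S :\: P \subset ~: P := subsetDr S P.
pose F (P S : {set I}) := f _ (restrict P g) *
  h _ (pull_sub (incl (PS P S)) (contract P g)) * k _ (contract S g).
transitivity (\sum_(P : {set I}) \sum_(S : {set I} | P \subset S) F P S).
  apply: eq_bigr => P _; rewrite sum_part_up mulr_sumr; apply: eq_bigr => Q _.
  rewrite mulrA /F; congr (_ * _ * _).
    apply: f_sub => //; [exact: val_inj|exact: incl_inj|move=> x].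
    rewrite codom_val codom_incl !inE mem_imset; last exact: val_inj.
    by have := valP x; rewrite inE => /negbTE ->.
  rewrite /contract pull_quo_quo; try exact: val_inj.
  apply: f_quo => //; [exact: inj_comp val_inj val_inj|exact: val_inj|move=> x].
  rewrite codom_val !inE; apply/codomP/idP => [[y ->] /=|].
    rewrite mem_imset; last exact: val_inj.
    have := valP y; rewrite inE => /negbTE ->; rewrite orbF.
    by have := valP (val y); rewrite inE.
  rewrite negb_or => /andP[xP xQ]; rewrite -in_setC in xP.
  have yQ : mkp xP \in ~: Q.
    by rewrite inE; apply: contra xQ => ?; apply/imsetP; exists (mkp xP).
  by exists (mkp yQ).
rewrite (exchange_big_dep predT) //=; apply: eq_bigr => S _.
rewrite sum_part mulr_suml; apply: eq_bigr => Q _; rewrite /F; congr (_ * _ * _).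
  rewrite /restrict pull_sub_sub; try exact: val_inj.
  apply: f_sub => //; [exact: val_inj|exact: inj_comp val_inj val_inj|move=> x].
  rewrite codom_val; apply/imsetP/codomP => [[y yQ ->]|[y ->]].
    by exists (exist _ y yQ).
  by exists (val y) => //; exact: valP.
set P := val @: Q.
have DS : S :\: P \subset S := subsetDl S P.
rewrite -(@pull_quo_sub _ _ _ _ (incl DS) val) //; last first.
- move=> x; rewrite !codom_val inE; case: (boolP (x \in P)) => xP /=.
    by case/imsetP: xP => y _ ->; exact: valP.
  by rewrite inE xP.
- exact: val_inj.
- exact: incl_inj.
- exact: val_inj.
- exact: incl_inj.
apply: f_quo => //; [exact: incl_inj|exact: val_inj|move=> x].
rewrite codom_val codom_incl !inE (valP x) andbT mem_imset //; exact: val_inj.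
Qed.

(** The convolution inverse, obtained by solving [conv f (binv f) = beps] for the
    term of [S = set0].  The argument [n] only bounds the number of vertices; see
    [binvE], [conv_binvr] and [conv_binvl]. *)
Fixpoint binv_rec f (n : nat) (I : finType) (g : graph I) : K :=
  if n is n'.+1 then
    if #|I| == 0%N then 1 else
    - \sum_(S : {set I} | S != set0) f _ (restrict S g) * binv_rec f n' (contract S g)
  else 1.
Definition binv f (I : finType) (g : graph I) : K := binv_rec f #|I| g.

Lemma binv_rec_iso f n : b_iso f -> b_iso (@binv_rec f n).
Proof.
move=> fi; elim: n => [|n IH] I J s g bs //=.
rewrite (bij_eq_card bs); case: ifP => // _; congr (- _).
under eq_bigl do rewrite -cards_eq0.
under [RHS]eq_bigl do rewrite -cards_eq0.
exact: (conv_iso_sum (fun n => n != 0%N)).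
Qed.

Lemma card_compl_lt (I : finType) (S : {set I}) n : S != set0 -> (#|I| <= n.+1)%N ->
  (#|~: S| <= n)%N.
Proof.
rewrite -card_gt0 -(cardsC S) => S0 le; rewrite -ltnS; apply: leq_trans le.
by rewrite -add1n leq_add2r.
Qed.

Lemma binv_rec_stable f n m (I : finType) (g : graph I) :
  (#|I| <= n)%N -> (#|I| <= m)%N -> binv_rec f n g = binv_rec f m g.
Proof.
elim: n m I g => [|n IH] [|m] I g //=.
- by rewrite leqn0 => ->.
- by rewrite leqn0 => _ ->.
move=> ln lm; case: ifP => // _; congr (- _); apply: eq_bigr => S S0; congr (_ * _).
by apply: IH; rewrite card_part card_compl_lt.
Qed.

Lemma binv_iso f : b_iso f -> b_iso (binv f).
Proof.
move=> fi I J s g bs; rewrite /binv (bij_eq_card bs); exact: binv_rec_iso.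
Qed.

Lemma binv_one f : b_one (binv f).
Proof. by move=> I g I0; rewrite /binv I0. Qed.

Lemma binvE f (I : finType) (g : graph I) : #|I| != 0%N ->
  binv f g = - \sum_(S : {set I} | S != set0) f _ (restrict S g) * binv f (contract S g).
Proof.
rewrite {1}/binv; case E: #|I| => [|n] //= _; rewrite E /=.
congr (- _); apply: eq_bigr => S S0; congr (_ * _).
by apply: binv_rec_stable; rewrite card_part // card_compl_lt ?E.
Qed.

Lemma conv_binvr f (I : finType) (g : graph I) : b_iso f -> b_one f ->
  conv f (binv f) g = beps g.
Proof.
move=> fi f1; rewrite /conv (bigD1 set0) //= f_contract0; last exact: binv_iso.
rewrite f1 ?card_part ?cards0 // mul1r /beps.
case: (eqVneq #|I| 0%N) => I0.
  rewrite binv_one // big1 ?addr0 // => S; by rewrite (card0_set I0 S) eqxx.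
by rewrite binvE // addNr.
Qed.

Lemma binv_mul f : b_iso f -> b_one f -> b_mul f -> b_mul (binv f).
Proof.
move=> fi f1 fm I S g1 g2; suff H n : b_mul_le n (binv f) by apply: (H #|I|).
elim: n {I S g1 g2} => [|n IH] I S g1 g2.
  rewrite leqn0 => /eqP I0.
  by rewrite !binv_one ?mul1r // ?card0_part.
move=> le; case: (eqVneq #|I| 0%N) => I0.
  by rewrite !binv_one ?mul1r // ?card0_part.
have fvi := binv_iso fi.
have g00 : glue (set0 : {set {x | x \in S}}, set0 : {set {x | x \in ~: S}}) = set0.
  by rewrite /glue !imset0 setU0.
have := conv_binvr g1 fi f1; have := conv_binvr g2 fi f1 => E2 E1.
have : conv f (binv f) g1 * conv f (binv f) g2 = 0.
  rewrite E1 E2 /beps !card_part -natrM mulnb -addn_eq0 cardsC (negbTE I0) //.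
rewrite /conv sum_glue (bigD1 (set0, set0)) //=.
rewrite !f_contract0 // !f1 ?card_part ?cards0 // !mul1r => /eqP.
rewrite addr_eq0 => /eqP ->; rewrite binvE //; congr (- _).
rewrite (reindex _ (onW_bij _ (glue_bij S))) /=; apply: eq_big => [U|U U0].
  by rewrite -(inj_eq (bij_inj (glue_bij S))) g00.
by apply: (conv_dunion_term (n := n)) => //; apply: card_compl_lt.
Qed.

Lemma conv_binvl f (I : finType) (g : graph I) : b_iso f -> b_one f ->
  conv (binv f) f g = beps g.
Proof.
move=> fi f1; have vi := binv_iso fi; have v1 := @binv_one f.
have wi := binv_iso vi.
have ei : b_iso beps by move=> A B s h bs; rewrite /beps (bij_eq_card bs).
have cf : b_iso (conv (binv f) f) by exact: conv_iso.
rewrite -(conv_epsr g cf).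
have -> : conv (conv (binv f) f) beps g =
          conv (conv (binv f) f) (conv (binv f) (binv (binv f))) g.
  by apply: eq_bigr => S _; rewrite conv_binvr.
rewrite -conv_assoc //; last exact: conv_iso.
rewrite -(conv_binvr g vi v1); apply: eq_bigr => S _; congr (_ * _).
rewrite conv_assoc // -[RHS]conv_epsl //.
by apply: eq_bigr => X _; rewrite conv_binvr.
Qed.
End BasisChar.

Section Linear.
Variables (K : fieldType) (T : choiceType).

(** Linear extension of a map defined on the basis [T]. *)
Definition lin (V : lmodType K) (f : T -> V) (x : {malg K[T]}) : V :=
  \sum_(t <- msupp x) x@_t *: f t.

Definition linform (f : T -> K) (x : {malg K[T]}) : K :=
  \sum_(t <- msupp x) x@_t * f t.

Lemma linEw (V : lmodType K) (f : T -> V) (d : {fset T}) x :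
  fsubset (msupp x) d -> lin f x = \sum_(t <- d) x@_t *: f t.
Proof.
move=> le; rewrite /lin (big_fset_incl _ le) //= => t _ /mcoeff_outdom ->.
by rewrite scale0r.
Qed.

Lemma lin_linear (V : lmodType K) (f : T -> V) : linear (lin f).
Proof.
move=> a x y.
have le1 : fsubset (msupp x) (msupp x `|` msupp y)%fset by apply: fsubsetUl.
have le2 : fsubset (msupp y) (msupp x `|` msupp y)%fset by apply: fsubsetUr.
have le3 : fsubset (msupp (a *: x + y)) (msupp x `|` msupp y)%fset.
  apply: fsubset_trans (msuppD_le _ _) _; apply: fsetSU; exact: msuppZ_le.
rewrite (linEw f le1) (linEw f le2) (linEw f le3) scaler_sumr -big_split /=.
by apply: eq_bigr => t _; rewrite mcoeffD mcoeffZ scalerDl scalerA.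
Qed.
HB.instance Definition _ (V : lmodType K) (f : T -> V) :=
  GRing.isLinear.Build K {malg K[T]} V *:%R (lin f) (lin_linear f).

Lemma linform_linear (f : T -> K) : linear_for *%R (linform f).
Proof. exact: (@lin_linear K^o f). Qed.
HB.instance Definition _ (f : T -> K) :=
  GRing.isLinear.Build K {malg K[T]} K *%R (linform f) (linform_linear f).

Lemma linU (V : lmodType K) (f : T -> V) t : lin f << t >> = f t.
Proof. by rewrite /lin msuppU oner_eq0 big_seq_fset1 mcoeffUU scale1r. Qed.

Lemma linformU (f : T -> K) t : linform f << t >> = f t.
Proof. exact: (@linU K^o). Qed.

Lemma linE (x : {malg K[T]}) : x = lin (fun t => << t >>) x.
Proof.
rewrite [LHS]monalgE /lin; apply: eq_bigr => t _; apply/malgP => u.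
by rewrite mcoeffZ !mcoeffU mulrnAr mulr1.
Qed.

Lemma scalar_lin (phi : {scalar {malg K[T]}}) (V : choiceType) (f : V -> {malg K[T]})
  (x : {malg K[V]}) : phi (\sum_(t <- msupp x) x@_t *: f t) =
  \sum_(t <- msupp x) x@_t * phi (f t).
Proof. by rewrite linear_sum; apply: eq_bigr => t _; rewrite linearZ. Qed.

Lemma scalar_ext (phi psi : {scalar {malg K[T]}}) :
  (forall t, phi << t >> = psi << t >>) -> phi = psi.
Proof.
move=> h; have E : phi =1 psi.
  move=> x; rewrite (linE x) /lin !scalar_lin; by apply: eq_bigr => t _; rewrite h.
move: E {h}; case: phi => f [[a] [b]]; case: psi => f' [[a'] [b']] /= /funext E.
by subst f'; rewrite (Prop_irrelevance a a') (Prop_irrelevance b b').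
Qed.
End Linear.

Section Characters.
Variable K : fieldType.

Definition vrelabel (I J : finType) (s : I -> J) (x : {malg K[graph I]}) :
    {malg K[graph J]} :=
  lin (fun g => << relabel s g >>) x.

(** Bilinear extension of the disjoint union. *)
Definition vmul (I : finType) (S : {set I})
    (x : {malg K[graph {x | x \in S}]}) (y : {malg K[graph {x | x \in ~: S}]}) :
    {malg K[graph I]} :=
  lin (fun g => lin (fun h => << dunion g h >>) y) x.

(** In [char_mul], I = S + T is the ordered decomposition with T = ~: S.  In
    [char_one], [g] is the only graph on the empty vertex set [I]. *)
Record character := Character {
  char_fun :> forall I : finType, {scalar {malg K[graph I]}};
  char_relabel : forall (I J : finType) (s : I -> J) (x : {malg K[graph I]}),
    bijective s -> char_fun J (vrelabel s x) = char_fun I x;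
  char_mul : forall (I : finType) (S : {set I})
      (x : {malg K[graph {x | x \in S}]}) (y : {malg K[graph {x | x \in ~: S}]}),
    char_fun I (vmul x y) = char_fun _ x * char_fun _ y;
  char_one : forall (I : finType) (g : graph I), #|I| = 0%N -> char_fun I << g >> = 1
}.

Lemma character_ext (phi psi : character) :
  (forall (I : finType) (g : graph I), phi I << g >> = psi I << g >>) -> phi = psi.
Proof.
move=> h; case: phi psi h => f f1 f2 f3 [f' f1' f2' f3'] /= h.
have E : f = f'.
  by apply: functional_extensionality_dep => I; apply: scalar_ext.
by subst f'; congr Character; exact: Prop_irrelevance.
Qed.

Definition on_graphs (phi : character) (I : finType) (g : graph I) : K := phi I << g >>.

Lemma on_graphs_iso phi : b_iso (@on_graphs phi).
Proof. by move=> I J s g bs; rewrite /on_graphs -(char_relabel _ _ bs) /vrelabel linU. Qed.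

Lemma on_graphs_mul phi : b_mul (@on_graphs phi).
Proof. by move=> I S g h; rewrite /on_graphs -char_mul /vmul !linU. Qed.

Lemma on_graphs_one phi : b_one (@on_graphs phi).
Proof. exact: char_one. Qed.

Section Extend.
Variable f : forall I : finType, graph I -> K.
Hypotheses (fi : b_iso f) (fm : b_mul f) (f1 : b_one f).

Let F (I : finType) : {scalar {malg K[graph I]}} := linform (@f I).

Fact extend_relabel (I J : finType) (s : I -> J) (x : {malg K[graph I]}) :
  bijective s -> F J (vrelabel s x) = F I x.
Proof.
move=> bs; rewrite /vrelabel /lin scalar_lin; apply: eq_bigr => g _.
by rewrite /F /= linformU fi.
Qed.

Fact extend_mul (I : finType) (S : {set I})
    (x : {malg K[graph {x | x \in S}]}) (y : {malg K[graph {x | x \in ~: S}]}) :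
  F I (vmul x y) = F _ x * F _ y.
Proof.
have FE J z : F J z = \sum_(g <- msupp z) z@_g * f g by [].
rewrite /vmul /lin scalar_lin (FE _ x) mulr_suml; apply: eq_bigr => g _.
rewrite scalar_lin -mulrA FE [f g * _]mulr_sumr; congr (_ * _); apply: eq_bigr => h _.
by rewrite [F I _]linformU fm mulrCA.
Qed.

Fact extend_one (I : finType) (g : graph I) : #|I| = 0%N -> F I << g >> = 1.
Proof. by move=> I0; rewrite /F /= linformU f1. Qed.

Definition extend : character := Character extend_relabel extend_mul extend_one.

Lemma extendE (I : finType) (g : graph I) : extend I << g >> = f g.
Proof. exact: linformU. Qed.
End Extend.

Fact beps_iso : b_iso (@beps K).
Proof. by move=> A B s h bs; rewrite /beps (bij_eq_card bs). Qed.
Fact beps_mul : b_mul (@beps K).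
Proof. by move=> I S g h; rewrite /beps !card_part -natrM mulnb -addn_eq0 cardsC. Qed.
Fact beps_one : b_one (@beps K).
Proof. by move=> I g I0; rewrite /beps I0. Qed.

Definition chone : character := extend beps_iso beps_mul beps_one.

Definition chmul (phi psi : character) : character :=
  extend (conv_iso (@on_graphs_iso phi) (@on_graphs_iso psi))
    (conv_mul (@on_graphs_iso phi) (@on_graphs_iso psi)
       (@on_graphs_mul phi) (@on_graphs_mul psi))
    (conv_one (@on_graphs_one phi) (@on_graphs_one psi)).

Definition chinv (phi : character) : character :=
  extend (binv_iso (@on_graphs_iso phi))
    (binv_mul (@on_graphs_iso phi) (@on_graphs_one phi) (@on_graphs_mul phi))
    (@binv_one _ (@on_graphs phi)).

Definition chexp (phi : character) (n : nat) : character :=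
  iter n (chmul phi) chone.

Definition chexpz (phi : character) (c : int) : character :=
  match c with Posz n => chexp phi n | Negz n => chexp (chinv phi) n.+1 end.

Lemma chmulE phi psi (I : finType) (g : graph I) :
  chmul phi psi I << g >> =
  \sum_(S : {set I}) phi _ << restrict S g >> * psi _ << contract S g >>.
Proof. by rewrite extendE. Qed.

Lemma chmulA : associative chmul.
Proof.
move=> a b c; apply: character_ext => I g; rewrite !extendE.
transitivity (conv (@on_graphs a) (conv (@on_graphs b) (@on_graphs c)) g).
  by apply: eq_bigr => S _; rewrite /on_graphs extendE.
rewrite conv_assoc; try exact: on_graphs_iso.
by apply: eq_bigr => S _; rewrite /on_graphs extendE.
Qed.

Lemma chmul1c : left_id chone chmul.
Proof.
move=> a; apply: character_ext => I g; rewrite extendE -[RHS]/(on_graphs a g).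
rewrite -(conv_epsl _ (@on_graphs_iso a)).
by apply: eq_bigr => S _; rewrite /on_graphs extendE.
Qed.

Lemma chmulc1 : right_id chone chmul.
Proof.
move=> a; apply: character_ext => I g; rewrite extendE -[RHS]/(on_graphs a g).
rewrite -(conv_epsr _ (@on_graphs_iso a)).
by apply: eq_bigr => S _; rewrite /on_graphs extendE.
Qed.

Lemma chmulVc : left_inverse chone chinv chmul.
Proof.
move=> a; apply: character_ext => I g; rewrite !extendE.
rewrite -(conv_binvl _ (@on_graphs_iso a) (@on_graphs_one a)).
by apply: eq_bigr => S _; rewrite /on_graphs extendE.
Qed.

Lemma chmulcV : right_inverse chone chinv chmul.
Proof.
move=> a; apply: character_ext => I g; rewrite !extendE.
rewrite -(conv_binvr _ (@on_graphs_iso a) (@on_graphs_one a)).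
by apply: eq_bigr => S _; rewrite /on_graphs extendE.
Qed.

Definition bxi (k : K) (I : finType) (g : graph I) : K := k ^+ #|I|.

Fact bxi_iso k : b_iso (@bxi k).
Proof. by move=> I J s g bs; rewrite /bxi (bij_eq_card bs). Qed.
Fact bxi_mul k : b_mul (@bxi k).
Proof. by move=> I S g h; rewrite /bxi !card_part -exprD cardsC. Qed.
Fact bxi_one k : b_one (@bxi k).
Proof. by move=> I g I0; rewrite /bxi I0. Qed.

Definition xi (k : K) : character := extend (@bxi_iso k) (@bxi_mul k) (@bxi_one k).

(** There is no edge joining two distinct vertices; half-edges are allowed. *)
Definition noedge (I : finType) (g : graph I) : bool :=
  [forall e : edge I, (#|e| == 2) ==> (g e == 0%N)].

Lemma noedge_relabel (I J : finType) (s : I -> J) (g : graph I) :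
  injective s -> noedge (relabel s g) = noedge g.
Proof.
move=> inj; apply/forallP/forallP => H e; apply/implyP => e2.
  have P : (#|s @: e| == 1%N) || (#|s @: e| == 2) by rewrite card_imset // e2 orbT.
  move: (H (Edge P)) => /=; rewrite card_imset // e2 ffunE sum_nat_eq0 => /forallP /(_ e).
  by rewrite insubE eqxx.
rewrite ffunE sum_nat_eq0; apply/forallP => e'; apply/implyP; rewrite insubE => /eqP E.
by move: (H e'); rewrite -(card_imset _ inj) E e2.
Qed.

Lemma noedgeD (I : finType) (g h : graph I) : noedge (g + h) = noedge g && noedge h.
Proof.
apply/forallP/andP => [H|[/forallP Hg /forallP Hh] e].
  split; apply/forallP => e; apply/implyP => e2; move: (H e);
  by rewrite e2 ffunE /= addn_eq0 => /andP[].
by apply/implyP => e2; move: (Hg e) (Hh e); rewrite e2 ffunE /= => /eqP -> /eqP ->.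
Qed.

Definition bzeta (I : finType) (g : graph I) : K := (noedge g)%:R.

Fact bzeta_iso : b_iso bzeta.
Proof. by move=> I J s g bs; rewrite /bzeta noedge_relabel //; exact: bij_inj. Qed.
Fact bzeta_mul : b_mul bzeta.
Proof.
by move=> I S g h; rewrite /bzeta noedgeD !noedge_relabel -?natrM ?mulnb //; exact: val_inj.
Qed.
Fact bzeta_one : b_one bzeta.
Proof.
move=> I g I0; rewrite /bzeta (_ : noedge g) //; apply/forallP => e.
by have := edge_card e; rewrite (card0_set I0 e) cards0.
Qed.

Definition zeta : character := extend bzeta_iso bzeta_mul bzeta_one.

End Characters.

Arguments chone {K}.
Arguments zeta {K}.

Definition complete (I : finType) : graph I := [ffun e : edge I => (#|e| == 2) : nat].

Definition derangements (n : nat) : {set 'S_n} :=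
  [set s : 'S_n | [forall i, s i != i]].

(** Linear orderings of subsets of [n]: repetition-free words, whose length is
    automatically at most [n]. *)
Definition arrangements (n : nat) : {set n.-bseq 'I_n} :=
  [set w : n.-bseq 'I_n | uniq w].

Record fps (K : Type) := Fps { coef : nat -> K }.

Section FormalPowerSeries.
Variable K : fieldType.
Implicit Types a b c : fps K.

HB.instance Definition _ := gen_eqMixin (fps K).
HB.instance Definition _ := gen_choiceMixin (fps K).

Lemma fpsP a b : coef a =1 coef b -> a = b.
Proof. by case: a b => f [g] /= /funext ->. Qed.

Definition fps_add a b := Fps (fun n => coef a n + coef b n).
Definition fps_opp a := Fps (fun n => - coef a n).
Definition fps_const (x : K) := Fps (fun n => if n == 0%N then x else 0).
Definition fps_mul a b := Fps (fun n => \sum_(i < n.+1) coef a i * coef b (n - i)).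

Fact fps_addA : associative fps_add.
Proof. by move=> a b c; apply: fpsP => n /=; rewrite addrA. Qed.
Fact fps_addC : commutative fps_add.
Proof. by move=> a b; apply: fpsP => n /=; rewrite addrC. Qed.
Fact fps_add0 : left_id (fps_const 0) fps_add.
Proof. by move=> a; apply: fpsP => n /=; rewrite if_same add0r. Qed.
Fact fps_addN : left_inverse (fps_const 0) fps_opp fps_add.
Proof. by move=> a; apply: fpsP => n /=; rewrite if_same addNr. Qed.

HB.instance Definition _ :=
  GRing.isZmodule.Build (fps K) fps_addA fps_addC fps_add0 fps_addN.

Definition fps_trunc n a : {poly K} := \poly_(i < n) coef a i.

Lemma coef_fps_trunc n a i : (i < n)%N -> (fps_trunc n a)`_i = coef a i.
Proof. by rewrite coef_poly => ->. Qed.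

Lemma coef_fps_mul n m a b : (m < n)%N ->
  coef (fps_mul a b) m = (fps_trunc n a * fps_trunc n b)`_m.
Proof.
move=> mn; rewrite coefM; apply: eq_bigr => i _; rewrite !coef_fps_trunc //.
  exact: leq_ltn_trans (leq_subr _ _) mn.
by apply: leq_ltn_trans mn; rewrite -ltnS.
Qed.

Fact fps_mulC : commutative fps_mul.
Proof. by move=> a b; apply: fpsP => n; rewrite !(@coef_fps_mul n.+1) // mulrC. Qed.
Fact fps_mulA : associative fps_mul.
Proof.
move=> a b c; apply: fpsP => n; rewrite !(@coef_fps_mul n.+1) //.
transitivity ((fps_trunc n.+1 a * (fps_trunc n.+1 b * fps_trunc n.+1 c))`_n).
  rewrite !coefM; apply: eq_bigr => i _; congr (_ * _).
  by rewrite coef_fps_trunc ?(@coef_fps_mul n.+1) // ltnS leq_subr.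
rewrite mulrA !coefM; apply: eq_bigr => i _; congr (_ * _).
by rewrite coef_fps_trunc ?(@coef_fps_mul n.+1).
Qed.
Fact fps_mul1 : left_id (fps_const 1) fps_mul.
Proof.
move=> a; apply: fpsP => n /=; rewrite big_ord_recl /= mul1r subn0 big1 ?addr0 //.
by move=> i _; rewrite mul0r.
Qed.
Fact fps_mulDl : left_distributive fps_mul fps_add.
Proof.
move=> a b c; apply: fpsP => n /=; rewrite -big_split /=.
by apply: eq_bigr => i _; rewrite mulrDl.
Qed.
Fact fps_one_neq0 : fps_const 1 != 0.
Proof. by apply/eqP => /(congr1 (fun a => coef a 0)) /= /eqP; rewrite oner_eq0. Qed.

HB.instance Definition _ := GRing.Zmodule_isComNzRing.Build (fps K)
  fps_mulA fps_mulC fps_mul1 fps_mulDl fps_one_neq0.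

Definition fps_unit : pred (fps K) := fun a => coef a 0 != 0.

Fixpoint inv_coef a (m n : nat) : K :=
  if n == 0%N then (coef a 0)^-1 else
  if m is m'.+1 then
    - (coef a 0)^-1 * \sum_(i < n) coef a (n - i) * inv_coef a m' i
  else 0.

Definition fps_inv a : fps K :=
  if fps_unit a then Fps (fun n => inv_coef a n n) else a.

Lemma inv_coef_stable a m m' n : (n <= m)%N -> (n <= m')%N ->
  inv_coef a m n = inv_coef a m' n.
Proof.
elim: m m' n => [|m IH] [|m'] n //=; rewrite ?leqn0; try by [move=> -> | move=> _ ->].
move=> nm nm'; case: ifP => // _; congr (_ * _); apply: eq_bigr => i _; congr (_ * _).
apply: IH; rewrite -ltnS; exact: leq_trans (ltn_ord i) _.
Qed.

Fact fps_mulVr : {in fps_unit, left_inverse 1 fps_inv *%R}.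
Proof.
move=> a a0; rewrite mulrC; apply: fpsP => n.
have ua : fps_unit a by exact: a0.
rewrite /fps_inv ua; rewrite -[_ \in _]/(coef a 0 != 0) in a0.
rewrite [LHS]/= big_ord_recl /= subn0; case: n => [|n].
  by rewrite big_ord0 addr0 /= mulfV.
rewrite /= mulNr mulrN mulrA mulfV // mul1r addrC; apply/eqP; rewrite subr_eq0; apply/eqP.
rewrite [RHS](reindex_inj rev_ord_inj) /=; apply: eq_bigr => i _.
rewrite /bump /= add1n subKn // subSS; congr (_ * _).
by apply: inv_coef_stable => //; rewrite leq_subr.
Qed.
Fact fps_unitP : forall a b, b * a = 1 -> fps_unit a.
Proof.
move=> a b /(congr1 (fun a => coef a 0)) /=; rewrite big_ord1 /= => E.
by apply/eqP => E0; move/eqP: E; rewrite E0 mulr0 eq_sym oner_eq0.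
Qed.
Fact fps_inv_out : {in [predC fps_unit], fps_inv =1 id}.
Proof. by move=> a; rewrite inE /= /fps_inv => /negbTE; rewrite -[_ \in _]/(fps_unit a) => ->. Qed.

HB.instance Definition _ := GRing.ComNzRing_hasMulInverse.Build (fps K)
  fps_mulVr fps_unitP fps_inv_out.

Definition fpsX : fps K := Fps (fun n => (n == 1%N)%:R).

(** The series e^(k x). *)
Definition fps_exp (k : K) : fps K := Fps (fun n => k ^+ n / n`!%:R).

Definition egf (a : nat -> K) : fps K := Fps (fun n => a n / n`!%:R).

End FormalPowerSeries.

Arguments fpsX {K}.

(* Main.v *)
Require Import Defs.
From mathcomp Require Import all_boot all_order all_fingroup all_algebra.
From mathcomp Require Import reals complex monalg.

(** Restricting the complete graph to S gives the complete graph on S, and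
    contracting S gives the complete graph on the complement, up to half-edges.
    A character whose value on such graphs depends only on the number of
    vertices is therefore recorded by an exponential generating series
    ([has_series]).  In a convolution, the n choose i decompositions whose first
    part has i elements contribute equally, which is the rule for multiplying
    exponential generating series ([has_series_mul]).  So phi |-> series of phi
    turns products and integer powers of characters into those of series.  The
    series of xi_k is e^(kx).  That of zeta is 1 + x, because a complete graph
    without edges has at most one vertex.  This gives the generating function.

    The difficulty is that contraction leaves the class of complete graphs, since
    it creates half-edges; the whole argument therefore runs on the class
    [near_complete] of graphs that are complete once their half-edges are
    forgotten.  This class is stable under restriction and contraction.

    For the two special values, the coefficients of e^(kx) / (1 + x) are
      (-1)^n sum_i (-k)^i n (n-1) ... (i+1).
    For k = 1 the sum is the inclusion-exclusion count of derangements, over the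
    sets of points required to be fixed ([card_derangements]).  For k = -1 it
    counts arrangements according to their length n - i
    ([card_arrangements]). *)

Set Implicit Arguments.
Unset Strict Implicit.
Unset Printing Implicit Defensive.

Import GRing.Theory Num.Theory.
Local Open Scope ring_scope.

Definition near_complete {I : finType} (g : graph I) : Prop :=
  forall e : edge I, #|e| = 2 -> g e = 1%N.

Lemma complete_near_complete (I : finType) : near_complete (complete I).
Proof. by move=> e e2; rewrite ffunE e2. Qed.

(** A pair of vertices of [A] is the trace of a single edge: an edge has at most
    two ends, so one whose trace is a pair lies in the image of [i].  Hence the
    half-edges produced by a contraction never add to the multiplicity of an
    edge with two ends. *)
Lemma preim_pair_eq (A I : finType) (i : A -> I) (e : edge I) (X : {set A}) :
  injective i -> #|X| = 2 -> (i @^-1: e == X) = (e == i @: X :> {set I}).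
Proof.
move=> inj X2; apply/eqP/eqP => [eX|->]; last first.
  by apply/setP => x; rewrite inE mem_imset.
apply/esym/eqP; rewrite eqEcard card_imset // X2 edge_le2 andbT.
by apply/subsetP => x /imsetP[y]; rewrite -eX inE => ? ->.
Qed.

Lemma near_complete_pull_sub (A I : finType) (i : A -> I) (g : graph I) :
  injective i -> near_complete g -> near_complete (pull_sub i g).
Proof.
move=> inj gc e' e2; rewrite ffunE.
have Xp : (#|i @: e'| == 1%N) || (#|i @: e'| == 2) by rewrite card_imset // e2 orbT.
rewrite (big_pred1 (Edge Xp)) => [|e]; first by rewrite gc //= card_imset.
rewrite -[RHS]/(ends e == i @: e'); case: ifPn => [_|nsub].
  by rewrite insubE preim_pair_eq.
apply/esym/eqP => eX; case/subsetP: nsub => x.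
by rewrite eX => /imsetP[y _ ->]; exact: codom_f.
Qed.

Lemma near_complete_pull_quo (A I : finType) (i : A -> I) (g : graph I) :
  injective i -> near_complete g -> near_complete (pull_quo i g).
Proof.
move=> inj gc e' e2; rewrite ffunE.
have Xp : (#|i @: e'| == 1%N) || (#|i @: e'| == 2) by rewrite card_imset // e2 orbT.
rewrite (big_pred1 (Edge Xp)) => [|e]; first by rewrite gc //= card_imset.
by rewrite insubE preim_pair_eq.
Qed.

Lemma sum_by_card (V : nmodType) (I : finType) (F : nat -> V) :
  \sum_(S : {set I}) F #|S| = \sum_(i < #|I|.+1) F i *+ 'C(#|I|, i).
Proof.
rewrite (partition_big (fun S : {set I} => inord #|S| : 'I_#|I|.+1) predT) //=.
apply: eq_bigr => i _; rewrite -(card_draws I i).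
rewrite (eq_bigl [in [set S : {set I} | #|S| == i]]) => [|S]; last first.
  by rewrite inE -val_eqE /= inordK // ltnS max_card.
rewrite (eq_bigr (fun=> F i)) => [|S]; last by rewrite inE => /eqP ->.
by rewrite sumr_const.
Qed.

Section Series.
Variable K : fieldType.
Implicit Types (phi psi : character K) (A B : fps K).

(** The exponential generating series of the values of [phi] on complete graphs
    is [A].  The factorial is on the side of [coef A] so that convolution can be
    treated without dividing, over any field. *)
Definition has_series phi A : Prop :=
  forall (I : finType) (g : graph I),
    near_complete g -> phi I << g >> = coef A #|I| *+ #|I|`!.

(** The product rule for exponential generating series; it comes down to
    n! = (n choose i) i! (n - i)!. *)
Lemma sum_series_mul A B (I : finType) :
  \sum_(S : {set I}) (coef A #|S| *+ #|S|`!) * (coef B #|~: S| *+ #|~: S|`!) =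
  coef (A * B) #|I| *+ #|I|`!.
Proof.
under eq_bigr => S _ do rewrite (cardsCs (~: S)) setCK.
rewrite (sum_by_card I (fun k => (coef A k *+ k`!) * (coef B (#|I| - k) *+ (#|I| - k)`!))).
rewrite [coef _ _]/= -sumrMnl; apply: eq_bigr => i _.
have le_i : (i <= #|I|)%N by rewrite -ltnS.
rewrite mulrnAl mulrnAr -!mulrnA -(bin_fact le_i).
by rewrite mulnA mulnC [(_ * i`!)%N]mulnC.
Qed.

Lemma has_series_mul phi psi A B :
  has_series phi A -> has_series psi B -> has_series (chmul phi psi) (A * B).
Proof.
move=> hA hB I g gc; rewrite chmulE -sum_series_mul; apply: eq_bigr => S _.
rewrite hA ?hB ?card_part //.
  by apply: near_complete_pull_quo gc; exact: val_inj.
by apply: near_complete_pull_sub gc; exact: val_inj.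
Qed.

Lemma has_series_one : has_series chone 1.
Proof.
move=> I g _; rewrite extendE /beps /=.
by case: #|I| => [|n]; rewrite ?mulr1n ?mul0rn.
Qed.

(** The constant term is the value on the empty graph. *)
Lemma has_series_coef0 phi A : has_series phi A -> coef A 0 = 1.
Proof.
move=> hA; have gc : near_complete (complete 'I_0) by exact: complete_near_complete.
by have := hA _ _ gc; rewrite char_one card_ord // mulr1n => <-.
Qed.

Lemma has_series_unit phi A : has_series phi A -> A \is a GRing.unit.
Proof. by move/has_series_coef0 => A0; rewrite -[_ \is a _]/(coef A 0 != 0) A0 oner_neq0. Qed.

(** Both the values of [chinv phi] and the coefficients of [A^-1] solve the same
    triangular system, phi * phi^-1 = 1: its term for [S = set0] is the unknown
    value itself, and the others only involve graphs with fewer vertices. *)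
Lemma has_series_inv phi A : has_series phi A -> has_series (chinv phi) A^-1.
Proof.
move=> hA I g gc; have [n] := ubnP #|I|; elim: n I g gc => // n IH I g gc le_n.
have quoc (S : {set I}) : near_complete (contract S g).
  by apply: near_complete_pull_quo gc; exact: val_inj.
have subc (S : {set I}) : near_complete (Defs.restrict S g).
  by apply: near_complete_pull_sub gc; exact: val_inj.
have E : chmul phi (chinv phi) I << g >> = coef (A * A^-1) #|I| *+ #|I|`!.
  by rewrite chmulcV mulrV ?(has_series_unit hA) // has_series_one.
(* Both sides are now sums over S; the terms with S nonempty agree by induction. *)
move: E; rewrite chmulE -sum_series_mul (bigD1 set0) //= [RHS](bigD1 set0) //=.
under eq_bigr => S S0.
  rewrite hA // IH // !card_part; last first.
    rewrite -(cardsC S) in le_n *; apply: leq_trans (le_n : (_ + _ <= n)%N).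
    by rewrite -add1n leq_add2r card_gt0.
  over.
move/addIr; rewrite hA // card_part cards0 (has_series_coef0 hA) mulr1n !mul1r.
have -> : #|~: (set0 : {set I})| = #|I| by rewrite setC0 cardsT.
by move=> <-; exact: esym (f_contract0 g (@on_graphs_iso _ (chinv phi))).
Qed.

Lemma has_series_exp phi A n : has_series phi A -> has_series (chexp phi n) (A ^+ n).
Proof.
move=> hA; elim: n => [|n IH]; first exact: has_series_one.
by rewrite exprS; exact: has_series_mul.
Qed.

Lemma has_series_expz phi A (c : int) : has_series phi A -> has_series (chexpz phi c) (A ^ c).
Proof.
move=> hA; case: c => n; first exact: has_series_exp.
by rewrite /exprz -exprVn; apply: has_series_exp; exact: has_series_inv.
Qed.

(** The series 1 + x is that of the sequence 1, 1, 0, 0, ...: from two vertices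
    on, a near-complete graph has an edge. *)
Lemma has_series_zeta : has_series zeta (1 + fpsX).
Proof.
move=> I g gc; rewrite extendE /bzeta.
have [I2|I2] := leqP 2 #|I|.
  have [x [y [_ _ xy]]] := card_gt1P I2.
  have S2 : #|[set x; y]| = 2 by rewrite cards2 xy.
  have -> : noedge g = false.
    have Sp : (#|[set x; y]| == 1%N) || (#|[set x; y]| == 2) by rewrite S2 orbT.
    by apply/negP => /forallP/(_ (Edge Sp)); rewrite gc ?S2.
  by move: I2; case: #|I| => [|[|m]] //= _; rewrite addr0 mul0rn.
have -> : noedge g.
  apply/forallP => e; apply/implyP => /eqP e2.
  by have := max_card (mem e); rewrite e2 leqNgt I2.
by move: I2; case: #|I| => [|[|m]] //= _; rewrite ?addr0 ?add0r.
Qed.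
End Series.

Lemma has_series_xi (K : numFieldType) (k : K) : has_series (xi k) (fps_exp k).
Proof.
move=> I g _; rewrite extendE /bxi /= -[RHS]mulr_natr divfK //.
by rewrite pnatr_eq0 -lt0n fact_gt0.
Qed.

Lemma coef_inv1DX (K : fieldType) n : coef ((1 + fpsX) : fps K)^-1 n = (-1) ^+ n.
Proof.
set G := (1 + fpsX : fps K).
have GU : G \is a GRing.unit by rewrite -[_ \is a _]/(coef G 0 != 0) /= addr0 oner_neq0.
suff <- : Fps (fun n => (-1) ^+ n) = G^-1 by [].
apply: (mulrI GU); rewrite mulrV //.
rewrite mulrDl mul1r; apply: fpsP => m /=.
case: m => [|m]; rewrite !big_ord_recl /= ?big_ord0 ?mul0r ?addr0 ?add0r //.
rewrite big1 => [|i _]; last by rewrite mul0r.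
by rewrite addr0 mul1r exprS mulN1r subSS subn0 addNr.
Qed.

(** The falling factorial n (n - 1) ... (i + 1), which is n! / i!, comes from the
    term of degree i of the exponential. *)
Lemma coef_exp_inv1DX (K : numFieldType) (k : K) n :
  coef (fps_exp k * (1 + fpsX)^-1) n *+ n`! =
  (-1) ^+ n * \sum_(i < n.+1) (- k) ^+ i *+ (n ^_ (n - i)).
Proof.
rewrite [coef _ _]/= -sumrMnl mulr_sumr; apply: eq_bigr => i _.
have le_i : (i <= n)%N by rewrite -ltnS.
rewrite coef_inv1DX -(ffact_fact (leq_subr i n)) subKn // mulnC mulrnA.
rewrite -mulrnAl -[_ / _ *+ _]mulr_natr divfK ?pnatr_eq0 -?lt0n ?fact_gt0 //.
have -> : (-1) ^+ (n - i) = (-1) ^+ n * (-1) ^+ i :> K.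
  by rewrite -[in X in _ = (-1) ^+ X * _](subnK le_i) exprD -mulrA -expr2 sqrr_sign mulr1.
by rewrite [(- k) ^+ i]exprNn mulrnAr mulrCA [k ^+ i * _]mulrC.
Qed.

(** Inclusion-exclusion: expanding the product over i of 1 - [s i = i] gives, for
    each set [S], the permutations fixing [S] pointwise, of which there are
    (n - |S|)!. *)
Lemma card_derangements (R : comNzRingType) n :
  #|derangements n|%:R = \sum_(i < n.+1) (-1) ^+ i *+ (n ^_ (n - i)) :> R.
Proof.
transitivity (\sum_(s : 'S_n) \prod_i (- (s i == i)%:R + 1) : R).
  rewrite -sum1_card natr_sum big_mkcond /=; apply: eq_bigr => s _.
  rewrite inE; case: ifPn => [/forallP nofix|/forallPn[i /negPn/eqP fix_i]].
    by rewrite big1 // => i _; rewrite (negbTE (nofix i)) oppr0 add0r.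
  by rewrite (bigD1 i) //= fix_i eqxx addNr mul0r.
(* Here S is the set of the factors in which the term - (s i == i) is chosen. *)
under eq_bigr do rewrite bigA_distr.
rewrite exchange_big /=.
transitivity (\sum_(S : {set 'I_n}) (-1) ^+ #|S| *+ (n - #|S|)`! : R).
  apply: eq_bigr => S _.
  have <- : #|perm_on (~: S)| = (n - #|S|)`!.
    by rewrite card_perm (cardsCs (~: S)) setCK card_ord.
  rewrite -sumr_const [RHS]big_mkcond /=; apply: eq_bigr => s _.
  rewrite -big_mkcond /=; case: ifPn => [/subsetP on_s|].
    rewrite -prodr_const; apply: eq_bigr => i iS.
    have -> : s i == i by apply: contraTT iS => /on_s; rewrite inE.
    by [].
  case/subsetPn => i; rewrite !inE negbK => si iS.
  by rewrite (bigD1 i) //= (negbTE si) oppr0 mul0r.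
rewrite (sum_by_card 'I_n (fun k => (-1) ^+ k *+ (n - k)`! : R)) card_ord.
apply: eq_bigr => i _; rewrite -mulrnA mulnC -bin_ffact bin_sub //.
by rewrite -ltnS.
Qed.

(** The words of length n - i are repetition-free tuples, counted by a falling
    factorial. *)
Lemma card_arrangements n :
  #|arrangements n| = (\sum_(i < n.+1) n ^_ (n - i))%N.
Proof.
(* After the reversal of the sum, i is the length of the word. *)
rewrite (reindex_inj rev_ord_inj) /=.
rewrite -sum1_card (partition_big
  (fun w : n.-bseq 'I_n => Ordinal (size_bseq w : size w < n.+1)%N) predT) //=.
apply: eq_bigr => i _; have le_i : (i <= n)%N by rewrite -ltnS.
rewrite subSS subKn // sum1dep_card -[X in X ^_ _](card_ord n) -card_uniq_tuples.
pose to_bseq (t : i.-tuple 'I_n) : n.-bseq 'I_n := widen_bseq le_i t.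
have to_bseq_inj : injective to_bseq.
  by move=> t u /(congr1 val) /= tu; apply: val_inj.
rewrite -(card_imset _ to_bseq_inj); apply: eq_card => w; rewrite !inE -val_eqE /=.
apply/andP/imsetP => [[w_uniq size_w]|[t]].
  exists (Tuple size_w); last exact: val_inj.
  by rewrite inE w_uniq andbT; apply/allP.
by rewrite inE => /andP[_ t_uniq] ->; rewrite t_uniq size_tuple.
Qed.

Section CompleteGraphs.
Variable K : numFieldType.

Lemma egf_xi_zeta_complete (k : K) (c : int) :
  egf (fun n => chmul (xi k) (chexpz zeta c) _ << complete 'I_n >>) =
  fps_exp k * (1 + fpsX) ^ c.
Proof.
have h := has_series_mul (has_series_xi k) (has_series_expz c (has_series_zeta K)).
apply: fpsP => n; rewrite [LHS]/= h ?card_ord; last exact: complete_near_complete.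
by rewrite -[coef _ _ *+ _]mulr_natr mulfK // pnatr_eq0 -lt0n fact_gt0.
Qed.

Lemma xi_zetaV_complete (k : K) n :
  chmul (xi k) (chinv zeta) _ << complete 'I_n >> =
  (-1) ^+ n * \sum_(i < n.+1) (- k) ^+ i *+ (n ^_ (n - i)).
Proof.
have h := has_series_mul (has_series_xi k) (has_series_inv (has_series_zeta K)).
by rewrite h ?card_ord ?coef_exp_inv1DX //; exact: complete_near_complete.
Qed.

Lemma xi1_zetaV_complete n :
  chmul (xi (1 : K)) (chinv zeta) _ << complete 'I_n >> =
  (-1) ^+ n * #|derangements n|%:R.
Proof. by rewrite xi_zetaV_complete card_derangements. Qed.

Lemma xiN1_zetaV_complete n :
  chmul (xi (-1 : K)) (chinv zeta) _ << complete 'I_n >> =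
  (-1) ^+ n * #|arrangements n|%:R.
Proof.
rewrite xi_zetaV_complete card_arrangements natr_sum opprK.
by congr (_ * _); apply: eq_bigr => i _; rewrite expr1n.
Qed.
End CompleteGraphs.

Theorem theorem13p11 (R : realType) :
  (forall (k : R[i]) (c : int),
    egf (fun n => chmul (xi k) (chexpz zeta c) _ << complete 'I_n >>)
    = fps_exp k * (1 + fpsX) ^ c) /\
  (forall n : nat,
    chmul (xi (1 : R[i])) (chinv zeta) _ << complete 'I_n >>
    = (-1) ^+ n * #|derangements n|%:R /\
    chmul (xi (-1 : R[i])) (chinv zeta) _ << complete 'I_n >>
    = (-1) ^+ n * #|arrangements n|%:R).
Proof.
split; first exact: egf_xi_zeta_complete.
by move=> n; split; [exact: xi1_zetaV_complete | exact: xiN1_zetaV_complete].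
Qed.
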